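(* Let $(\mathfrak g,[\cdot,\cdot,\cdot]_{\mathfrak g})$ be a finite-dimensional $3$-Lie algebra over $\mathbb R$ or $\mathbb C$. Then $\mathfrak g$ has a perfect product structure if and only if $\mathfrak g$ admits a decomposition $\mathfrak g=\mathfrak g_+\oplus\mathfrak g_-$ (direct sum of vector spaces), where $\mathfrak g_+$ and $\mathfrak g_-$ are nonzero subalgebras of $\mathfrak g$ such that $[\mathfrak g_+,\mathfrak g_+,\mathfrak g_-]_{\mathfrak g}\subset\mathfrak g_-$ and $[\mathfrak g_-,\mathfrak g_-,\mathfrak g_+]_{\mathfrak g}\subset\mathfrak g_+$.
   Context: A $3$-Lie algebra is a vector space $\mathfrak g$ with a trilinear skew-symmetric bracket $[\cdot,\cdot,\cdot]_{\mathfrak g}$ satisfying $[x,y,[z,w,v]]=[[x,y,z],w,v]+[z,[x,y,w],v]+[z,w,[x,y,v]]$. An almost product structure on $\mathfrak g$ is a linear map $E:\mathfrak g\to\mathfrak g$ with $E^2=\mathrm{Id}$ and $E\neq\pm\mathrm{Id}$. It is called a perfect product structure if $E[x,y,z]_{\mathfrak g}=[Ex,Ey,Ez]_{\mathfrak g}$ for all $x,y,z\in\mathfrak g$. *)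

(* Defs.v *)
(* The real numbers are an abstract R : realType, the complex numbers R[i]. *)
From mathcomp Require Import all_boot all_order all_algebra.
From mathcomp Require Import reals.
From mathcomp Require Import complex.

Set Implicit Arguments.
Unset Strict Implicit.
Unset Printing Implicit Defensive.

Import GRing.Theory.
Local Open Scope ring_scope.

Definition trilinear (K : fieldType) (g : lmodType K) (br : g -> g -> g -> g) :=
  [/\ forall y z, linear (fun x => br x y z),
      forall x z, linear (fun y => br x y z) &
      forall x y, linear (fun z => br x y z)].

(* The two adjacent transpositions generate the symmetric group on the three
   arguments. *)
Definition skew_symmetric (K : fieldType) (g : lmodType K)
    (br : g -> g -> g -> g) :=
  (forall x y z, br y x z = - br x y z) /\
  (forall x y z, br x z y = - br x y z).

Definition fundamental_identity (K : fieldType) (g : lmodType K)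
    (br : g -> g -> g -> g) :=
  forall x y z w v,
    br x y (br z w v) = br (br x y z) w v + br z (br x y w) v
                        + br z w (br x y v).

Record three_lie_bracket (K : fieldType) (g : lmodType K) := ThreeLieBracket {
  bracket :> g -> g -> g -> g;
  bracket_trilinear : trilinear bracket;
  bracket_skew : skew_symmetric bracket;
  bracket_fundamental : fundamental_identity bracket
}.

Section Structures.
Variables (K : fieldType) (g : vectType K) (br : three_lie_bracket g).
Implicit Types (E : 'End(g)) (U V W X : {vspace g}).

Definition almost_product_structure E :=
  [/\ (E \o E)%VF = \1%VF, E <> \1%VF & E <> - \1%VF].

Definition perfect_product_structure E :=
  almost_product_structure E /\
  forall x y z, E (br x y z) = br (E x) (E y) (E z).

(* [U, V, W] is contained in X; as X is a subspace, it is the same to take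
   [U, V, W] as the set of brackets or as its linear span. *)
Definition bracket_sub U V W X :=
  forall x y z, x \in U -> y \in V -> z \in W -> br x y z \in X.

Definition subalgebra U := bracket_sub U U U U.

Definition direct_sum_decomposition U V :=
  (U + V)%VS = fullv /\ (U :&: V)%VS = 0%VS.

End Structures.

(* Main.v *)
Require Import Defs.
From mathcomp Require Import all_boot all_order all_algebra.
From mathcomp Require Import reals.
From mathcomp Require Import complex.

(** A perfect product structure is the same thing as a nontrivial
    Z/2-grading of the 3-Lie algebra.

    Since 2 is invertible, an involution E is diagonalisable with eigenvalues
    in {1, -1}: it is determined by the direct sum decomposition of g into its
    two eigenspaces, and every such decomposition arises this way. Excluding
    E = 1 and E = -1 amounts to requiring both eigenspaces to be nonzero.
    Index the eigenspaces by booleans, g_s being that of (-1)^s. By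
    trilinearity, E preserves the bracket if and only if it does so on
    eigenvectors, where this reads [g_s, g_t, g_u] <= g_(s+t+u) with the sum
    taken modulo 2 ([morph_bracket_graded]). Up to a permutation of the
    arguments, harmless by skew-symmetry, there are only four such inclusions:
    the two subalgebra conditions and the two mixed ones of the theorem
    ([gradedP]). The argument works over any field of characteristic other
    than 2. *)

Set Implicit Arguments.
Unset Strict Implicit.
Unset Printing Implicit Defensive.

Import GRing.Theory.
Local Open Scope ring_scope.

Section Involutions.
Variables (K : fieldType) (g : vectType K).
Implicit Types (E : 'End(g)) (s : bool) (x : g).

Definition sign_eigenspace E s : {vspace g} :=
  lker (E - ((-1) ^+ s) *: \1%VF).

Lemma mem_sign_eigenspace E s x :
  (x \in sign_eigenspace E s) = (E x == (-1) ^+ s *: x).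
Proof.
by rewrite memv_ker add_lfunE opp_lfunE scale_lfunE id_lfunE subr_eq0.
Qed.

Hypothesis two_neq0 : 2%:R != 0 :> K.

Lemma oppr_eq_self x : x = - x -> x = 0.
Proof.
move/eqP; rewrite -addr_eq0 -mulr2n -scaler_nat scaler_eq0 (negPf two_neq0).
by move/eqP.
Qed.

Lemma involution_lfunE E : (E \o E)%VF = \1%VF -> forall x, E (E x) = x.
Proof. by move=> EE x; rewrite -comp_lfunE EE id_lfunE. Qed.

Lemma involution_eigenvector E s x :
  (E \o E)%VF = \1%VF -> x + (-1) ^+ s *: E x \in sign_eigenspace E s.
Proof.
move=> EE; rewrite mem_sign_eigenspace linearD linearZ /=.
by rewrite involution_lfunE // scalerDr scalerA -expr2 sqrr_sign scale1r addrC.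
Qed.

(** Averaging: 2 x = (x + E x) + (x - E x). *)
Lemma involution_direct_sum E : (E \o E)%VF = \1%VF ->
  direct_sum_decomposition (sign_eigenspace E false) (sign_eigenspace E true).
Proof.
move=> EE; split; last first.
  apply/eqP; rewrite -subv0; apply/subvP=> x.
  rewrite memv_cap !mem_sign_eigenspace expr0 scale1r expr1 scaleN1r.
  by case/andP=> /eqP-> /eqP/oppr_eq_self->; rewrite mem0v.
apply/eqP; rewrite eqEsubv subvf; apply/subvP=> x _.
have -> : x = 2%:R^-1 *: (x + (-1) ^+ false *: E x)
            + 2%:R^-1 *: (x + (-1) ^+ true *: E x).
  rewrite -scalerDr expr0 expr1 scale1r scaleN1r addrACA subrr addr0.
  by rewrite -mulr2n -scaler_nat scalerA mulVf // scale1r.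
by rewrite memv_add // memvZ // involution_eigenvector.
Qed.

(** The involution attached to a decomposition is the difference of the two
    projections. *)
Lemma direct_sum_involution (U V : {vspace g}) :
  direct_sum_decomposition U V ->
  exists E, [/\ (E \o E)%VF = \1%VF,
    sign_eigenspace E false = U & sign_eigenspace E true = V].
Proof.
case=> sumUV capUV; have capVU : (V :&: U)%VS = 0%VS by rewrite capvC.
pose E := daddv_pi U V - daddv_pi V U.
have EP x : E x = daddv_pi U V x - daddv_pi V U x.
  by rewrite add_lfunE opp_lfunE.
have dec x : daddv_pi U V x + daddv_pi V U x = x.
  by rewrite daddv_pi_add // sumUV memvf.
have piU x : x \in U -> daddv_pi U V x = x by apply: daddv_pi_id.
have piV x : x \in V -> daddv_pi V U x = x by apply: daddv_pi_id.
have piU0 x : x \in V -> daddv_pi U V x = 0.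
  by move=> xV; apply: (addIr (daddv_pi V U x)); rewrite dec add0r piV.
have piV0 x : x \in U -> daddv_pi V U x = 0.
  by move=> xU; apply: (addrI (daddv_pi U V x)); rewrite dec addr0 piU.
have EU x : x \in U -> E x = x by move=> xU; rewrite EP piU // piV0 // subr0.
have EV x : x \in V -> E x = - x by move=> xV; rewrite EP piV // piU0 // sub0r.
exists E; split.
- apply/lfunP=> x; rewrite comp_lfunE id_lfunE [E x]EP linearB /=.
  by rewrite EU ?memv_pi // EV ?memv_pi // opprK dec.
- apply/vspaceP=> x; rewrite mem_sign_eigenspace scale1r.
  apply/eqP/idP=> [Ex|/EU //].
  (* E x = x says that the V-component of x is its own opposite. *)
  have := Ex; rewrite EP -{3}[x]dec => /addrI/esym/oppr_eq_self piVx.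
  by rewrite -[x]dec piVx addr0 memv_pi.
- apply/vspaceP=> x; rewrite mem_sign_eigenspace expr1 scaleN1r.
  apply/eqP/idP=> [Ex|/EV //].
  have := Ex; rewrite EP -{3}[x]dec opprD => /addIr/oppr_eq_self piUx.
  by rewrite -[x]dec piUx add0r memv_pi.
Qed.

(** The image of E + (-1)^s lies in the eigenspace of (-1)^s. *)
Lemma sign_eigenspace_eq0 E s : (E \o E)%VF = \1%VF ->
  sign_eigenspace E s = 0%VS <-> E = - ((-1) ^+ s *: \1%VF).
Proof.
move=> EE; split=> [eig0|->].
  apply/lfunP=> x; rewrite opp_lfunE scale_lfunE id_lfunE.
  have := involution_eigenvector s x EE; rewrite eig0 memv0 addr_eq0 => /eqP xE.
  by rewrite [X in _ *: X]xE scalerN scalerA -expr2 sqrr_sign scale1r opprK.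
apply/eqP; rewrite -subv0; apply/subvP=> x.
rewrite mem_sign_eigenspace opp_lfunE scale_lfunE id_lfunE memv0.
by move/eqP/esym/oppr_eq_self/eqP; rewrite scaler_eq0 signr_eq0.
Qed.

Lemma almost_product_structureP E : almost_product_structure E <->
  [/\ (E \o E)%VF = \1%VF, sign_eigenspace E false <> 0%VS
    & sign_eigenspace E true <> 0%VS].
Proof.
split=> -[EE n1 n2]; have e0 := sign_eigenspace_eq0 false EE;
  have e1 := sign_eigenspace_eq0 true EE;
  rewrite scale1r in e0; rewrite expr1 scaleN1r opprK in e1.
- by split=> // [/e0|/e1].
- by split=> // [/e1|/e0].
Qed.

End Involutions.

Section Gradings.
Variables (K : fieldType) (g : vectType K) (br : three_lie_bracket g).
Implicit Types (E : 'End(g)) (U V W X : {vspace g}) (G : bool -> {vspace g}).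

(** A boolean is a degree in Z/2, where exclusive or is the addition. *)
Definition graded_bracket G :=
  forall s t u, bracket_sub br (G s) (G t) (G u) (G (s (+) t (+) u)).

Lemma bracket_sub_swap12 U V W X :
  bracket_sub br U V W X -> bracket_sub br V U W X.
Proof.
have [sk _] := bracket_skew br.
by move=> sub x y z xV yU zW; rewrite sk rpredN sub.
Qed.

Lemma bracket_sub_swap23 U V W X :
  bracket_sub br U V W X -> bracket_sub br U W V X.
Proof.
have [_ sk] := bracket_skew br.
by move=> sub x y z xU yW zV; rewrite sk rpredN sub.
Qed.

Lemma gradedP G : graded_bracket G <->
  [/\ subalgebra br (G false), subalgebra br (G true),
      bracket_sub br (G false) (G false) (G true) (G true) &
      bracket_sub br (G true) (G true) (G false) (G false)].
Proof.
split=> [gr|[s0 s1 m0 m1]].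
  by split; [apply: (gr false false false) | apply: (gr true true true)
    | apply: (gr false false true) | apply: (gr true true false)].
have m0' := bracket_sub_swap23 m0; have m1' := bracket_sub_swap23 m1.
case=> -[] [] //=; exact: bracket_sub_swap12.
Qed.

Let brDl y z : linear (fun x => br x y z).
Proof. by have [] := bracket_trilinear br. Qed.
Let brDm x z : linear (fun y => br x y z).
Proof. by have [] := bracket_trilinear br. Qed.
Let brDr x y : linear (br x y).
Proof. by have [] := bracket_trilinear br. Qed.

Lemma bracketD1 x x' y z : br (x + x') y z = br x y z + br x' y z.
Proof. by have := brDl y z 1 x x'; rewrite !scale1r. Qed.

Lemma bracketD2 x y y' z : br x (y + y') z = br x y z + br x y' z.
Proof. by have := brDm x z 1 y y'; rewrite !scale1r. Qed.

Lemma bracketD3 x y z z' : br x y (z + z') = br x y z + br x y z'.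
Proof. by have := brDr x y 1 z z'; rewrite !scale1r. Qed.

Lemma bracket_signZ (s t u : bool) x y z :
  br ((-1) ^+ s *: x) ((-1) ^+ t *: y) ((-1) ^+ u *: z)
    = (-1) ^+ (s (+) t (+) u) *: br x y z.
Proof.
have [sk1 sk2] := bracket_skew br.
have N3 a b c : br a b (- c) = - br a b c.
  have br0 : br a b 0 = 0.
    by apply: (addrI (br a b 0)); rewrite -bracketD3 !addr0.
  by apply/eqP; rewrite -addr_eq0 -bracketD3 addNr br0.
have N2 a b c : br a (- b) c = - br a b c by rewrite sk2 N3 -sk2.
have N1 a b c : br (- a) b c = - br a b c by rewrite sk1 N2 -sk1.
by case: s t u => -[] [] /=;
  rewrite ?expr0 ?expr1 ?scaleN1r ?scale1r ?N1 ?N2 ?N3 ?opprK.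
Qed.

Hypothesis two_neq0 : 2%:R != 0 :> K.

(** On eigenvectors both sides of E [x, y, z] = [E x, E y, E z] are explicit:
    the right-hand side is (-1)^(s+t+u) [x, y, z]. *)
Lemma morph_bracket_graded E : (E \o E)%VF = \1%VF ->
  (forall x y z, E (br x y z) = br (E x) (E y) (E z)) <->
  graded_bracket (sign_eigenspace E).
Proof.
move=> EE; split=> [Ebr s t u x y z|gr].
  rewrite !mem_sign_eigenspace => /eqP Ex /eqP Ey /eqP Ez.
  by rewrite Ebr Ex Ey Ez bracket_signZ.
have eigE s t u x y z : x \in sign_eigenspace E s ->
    y \in sign_eigenspace E t -> z \in sign_eigenspace E u ->
    E (br x y z) = br (E x) (E y) (E z).
  move=> xs yt zu; have := gr _ _ _ _ _ _ xs yt zu.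
  move: xs yt zu; rewrite !mem_sign_eigenspace.
  by move=> /eqP-> /eqP-> /eqP-> /eqP->; rewrite bracket_signZ.
have dec x : exists x0 x1, [/\ x0 \in sign_eigenspace E false,
    x1 \in sign_eigenspace E true & x = x0 + x1].
  have [sumE _] := involution_direct_sum two_neq0 EE.
  have : x \in fullv by exact: memvf.
  by rewrite -sumE => /memv_addP[x0 ? [x1 ? ->]]; exists x0, x1.
move=> x y z.
have [x0 [x1 [x0E x1E ->]]] := dec x.
have [y0 [y1 [y0E y1E ->]]] := dec y.
have [z0 [z1 [z0E z1E ->]]] := dec z.
rewrite !linearD /= !(bracketD1, bracketD2, bracketD3) !linearD /=.
rewrite (eigE _ _ _ _ _ _ x0E y0E z0E) (eigE _ _ _ _ _ _ x0E y0E z1E).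
rewrite (eigE _ _ _ _ _ _ x0E y1E z0E) (eigE _ _ _ _ _ _ x0E y1E z1E).
rewrite (eigE _ _ _ _ _ _ x1E y0E z0E) (eigE _ _ _ _ _ _ x1E y0E z1E).
by rewrite (eigE _ _ _ _ _ _ x1E y1E z0E) (eigE _ _ _ _ _ _ x1E y1E z1E).
Qed.

Lemma perfect_product_structureP :
  (exists E : 'End(g), perfect_product_structure br E) <->
  (exists gp gm : {vspace g},
     direct_sum_decomposition gp gm /\
     gp <> 0%VS /\ gm <> 0%VS /\
     subalgebra br gp /\ subalgebra br gm /\
     bracket_sub br gp gp gm gm /\
     bracket_sub br gm gm gp gp).
Proof.
split=> [[E [/(almost_product_structureP two_neq0)[EE n0 n1] Ebr]]|].
  exists (sign_eigenspace E false), (sign_eigenspace E true).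
  have /gradedP[s0 s1 m0 m1] := (morph_bracket_graded EE).1 Ebr.
  by split; first exact: involution_direct_sum.
case=> gp [gm [dec [n0 [n1 [s0 [s1 [m0 m1]]]]]]].
have [E [EE Egp Egm]] := direct_sum_involution two_neq0 dec.
subst gp gm; exists E; split.
  exact/(almost_product_structureP two_neq0).
by apply/(morph_bracket_graded EE)/gradedP.
Qed.

End Gradings.

Theorem corollary5p17 (R : realType) :
  (forall (g : vectType R) (br : three_lie_bracket g),
     (exists E : 'End(g), perfect_product_structure br E) <->
     (exists gp gm : {vspace g},
        direct_sum_decomposition gp gm /\
        gp <> 0%VS /\ gm <> 0%VS /\
        subalgebra br gp /\ subalgebra br gm /\
        bracket_sub br gp gp gm gm /\
        bracket_sub br gm gm gp gp)) /\
  (forall (g : vectType R[i]) (br : three_lie_bracket g),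
     (exists E : 'End(g), perfect_product_structure br E) <->
     (exists gp gm : {vspace g},
        direct_sum_decomposition gp gm /\
        gp <> 0%VS /\ gm <> 0%VS /\
        subalgebra br gp /\ subalgebra br gm /\
        bracket_sub br gp gp gm gm /\
        bracket_sub br gm gm gp gp)).
Proof.
by split=> g br; apply: perfect_product_structureP; rewrite Num.Theory.pnatr_eq0.
Qed.
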